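(* The number of $0/1$-matrices, counted up to permutation of rows and columns, that are slack matrices $S(A,B)$ of some $2$-level $d$-configuration $(A,B)$ with $A\subseteq\{0,1\}^d$ and $B\subseteq\mathbb{Z}^d$ is at most $2^{O(d^2\log d)}$.
   Context: A \emph{$2$-level $d$-configuration} is a pair $(A,B)$ of sets $A,B\subseteq\mathbb{R}^d$, each linearly spanning $\mathbb{R}^d$, such that $\langle a,b\rangle\in\{0,1\}$ for all $a\in A$, $b\in B$, and maximal with respect to this property: $A=\{a\in\mathbb{R}^d:\langle a,b\rangle\in\{0,1\}\ \forall b\in B\}$ and $B=\{b\in\mathbb{R}^d:\langle a,b\rangle\in\{0,1\}\ \forall a\in A\}$. Its \emph{slack matrix} $S(A,B)\in\{0,1\}^{|A|\times|B|}$ has rows indexed by $A$, columns indexed by $B$, and entries $S_{ab}=\langle a,b\rangle$. Logarithms are base $2$. *)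

(* Defs.v *)
From mathcomp Require Import all_boot all_order all_algebra all_fingroup.
From mathcomp Require Import all_classical all_reals all_analysis.

Set Implicit Arguments.
Unset Strict Implicit.
Unset Printing Implicit Defensive.

Import Order.TTheory GRing.Theory Num.Theory numFieldNormedType.Exports.

Local Open Scope classical_set_scope.
Local Open Scope ring_scope.

Section TwoLevelConfigurations.
Variables (R : realType) (d : nat).
Implicit Types (a b : 'rV[R]_d) (A B : set 'rV[R]_d).

Definition dotp a b : R := \sum_(i < d) a 0 i * b 0 i.

Definition linear_span A : set 'rV[R]_d :=
  [set v | exists2 X : seq 'rV[R]_d, [set` X] `<=` A & v \in <<X>>%VS].

Definition two_level_configuration A B : Prop :=
  [/\ linear_span A = setT,
      linear_span B = setT,
      A = [set a | forall b, B b -> dotp a b = 0 \/ dotp a b = 1] &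
      B = [set b | forall a, A a -> dotp a b = 0 \/ dotp a b = 1]].

Definition zero_one_vectors : set 'rV[R]_d :=
  [set a | forall i, a 0 i = 0 \/ a 0 i = 1].

Definition integer_vectors : set 'rV[R]_d :=
  [set b | forall i, b 0 i \is a Num.int].

(* The bijections [r] and [c] fix the order in which the elements of [A] and
   [B] index the rows and columns; the entries 0 and 1 are encoded as [false]
   and [true]. *)
Definition is_slack_matrix A B m n (S : 'M[bool]_(m, n)) : Prop :=
  exists (r : 'I_m -> 'rV[R]_d) (c : 'I_n -> 'rV[R]_d),
    [/\ set_bij setT A r, set_bij setT B c &
        forall i j, (S i j)%:R = dotp (r i) (c j)].

End TwoLevelConfigurations.

Definition bmatrix := {mn : nat * nat & 'M[bool]_(mn.1, mn.2)}.

Definition perm_class (S : bmatrix) : set bmatrix :=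
  [set T | exists (s : {perm 'I_(tag S).1}) (t : {perm 'I_(tag S).2}),
     T = Tagged (fun mn : nat * nat => 'M[bool]_(mn.1, mn.2))
                (row_perm s (col_perm t (tagged S)))].

Definition integral_slack_matrices (R : realType) (d : nat) : set bmatrix :=
  [set S | exists A B : set 'rV[R]_d,
     [/\ two_level_configuration A B,
         A `<=` @zero_one_vectors R d,
         B `<=` @integer_vectors R d &
         is_slack_matrix A B (tagged S)]].

Definition integral_slack_classes (R : realType) (d : nat) :
    set (set bmatrix) :=
  [set perm_class S | S in integral_slack_matrices R d].

Definition log2 (R : realType) (x : R) : R := ln x / ln 2.

(* Main.v *)
(* For integral [a] and [b] the quantity <a,b>^2 - <a,b> is nonnegative, and it
   vanishes exactly when <a,b> is 0 or 1.  Fix a basis a_1, ..., a_d of R^d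
   inside [A].  For a = sum_i x_i a_i this quantity is a linear function of the
   0/1 matrix N_b = (<a_i,b><a_j,b>)_ij, so if Y is a subset of [B], of size at
   most d^2, such that the N_b with b in Y span all the N_b with b in [B], then
   [A] is the set of 0/1 points at which the sum over b in Y of <a,b>^2 - <a,b>
   vanishes.  That sum depends only on x and on M = sum_(b in Y) N_b, whose
   entries are integers between 0 and d^2.  Hence [A] is determined by the d^2
   bits of the basis and by M, which leaves at most 2^(d^2) (d^2 + 1)^(d^2)
   sets [A]; and [A] determines [B], hence the slack matrix up to permutations
   of rows and columns. *)

Require Import Defs.
From HB Require Import structures.
From mathcomp Require Import all_boot all_order all_algebra all_fingroup.
From mathcomp Require Import all_classical all_reals all_analysis.
From mathcomp Require Import zify ring.

Import Order.TTheory GRing.Theory Num.Theory numFieldNormedType.Exports.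

Local Open Scope classical_set_scope.
Local Open Scope card_scope.
Local Open Scope ring_scope.

(** * Free families spanning a set of vectors *)

(** Lengths of free families inside [A] are bounded by [dim V], so one of maximal length exists; a
    vector of [A] outside its span would extend it. It provides both the basis inside [A] and the
    family [Y] of matrices [N_b]. *)
Lemma set_spanning_free (K : fieldType) (V : vectType K) (A : set V) :
  exists X : seq V, [/\ free X, {in X, forall v, A v} &
    forall v, A v -> v \in <<X>>%VS].
Proof.
pose P n := `[< exists X : seq V,
  [/\ free X, {in X, forall v, A v} & size X = n] >].
have exP : exists n, P n.
  by exists 0%N; apply/asboolP; exists [::]; rewrite nil_free.
have leP n : P n -> (n <= dim V)%N.
  move=> /asboolP[X [/eqP fX _ <-]].
  by rewrite -fX -dimvf dimvS// subvf.
case: (ex_maxnP exP leP) => n /asboolP[X [fX XA sX]] maxn.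
exists X; split=> // v Av; apply: contrapT => /negP vX.
have : P n.+1.
  apply/asboolP; exists (v :: X); split; last by rewrite /= sX.
    by rewrite free_cons vX fX.
  by move=> w; rewrite inE => /predU1P[->//|/XA].
by move=> /maxn; rewrite ltnn.
Qed.

(** * Enumerations of a set and permutation classes *)

Lemma reindex_bij {T : Type} {A : set T} {m n : nat}
    {r : 'I_m -> T} {s : 'I_n -> T} :
  set_bij setT A r -> set_bij setT A s ->
  exists2 f : 'I_n -> 'I_m, injective f & forall i, s i = r (f i).
Proof.
move=> [_ _ surj_r] [fun_s inj_s _].
have /fin_all_exists[f sf] (i : 'I_n) : exists j, s i = r j.
  by have [j _ <-] := surj_r _ (fun_s i I); exists j.
exists f => // i j fij; apply: inj_s; rewrite ?inE//.
by rewrite !sf fij.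
Qed.

Lemma reindex_perm {T : Type} {A : set T} {n : nat} {r s : 'I_n -> T} :
  set_bij setT A r -> set_bij setT A s ->
  exists p : {perm 'I_n}, forall i, s i = r (p i).
Proof.
move=> Ar As; have [f injf sf] := reindex_bij Ar As.
by exists (perm injf) => i; rewrite permE.
Qed.

Lemma bij_card_eq {T : Type} {A : set T} {m n : nat}
    {r : 'I_m -> T} {s : 'I_n -> T} :
  set_bij setT A r -> set_bij setT A s -> m = n.
Proof.
move=> Ar As; apply/eqP; rewrite eqn_leq.
have [f /leq_card lef _] := reindex_bij Ar As.
have [g /leq_card leg _] := reindex_bij As Ar.
by move: lef leg; rewrite !card_ord => -> ->.
Qed.

Lemma set_bij_perm {T : Type} {A : set T} {n : nat} {r : 'I_n -> T}
    (p : {perm 'I_n}) :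
  set_bij setT A r -> set_bij setT A (r \o p).
Proof.
move=> [fun_r inj_r surj_r]; split.
- by move=> i _; apply: fun_r.
- by move=> i j _ _ /= /inj_r/[!inE]/(_ I I)/perm_inj.
- move=> a /surj_r[i _ <-]; exists ((p^-1)%g i) => //=.
  by rewrite permKV.
Qed.

(** Two enumerations of the same set have equal length and differ by a permutation, so the class
    depends on the pair [(A, B)] only. *)
Lemma perm_class_slack {R : realType} {d : nat} {A B : set 'rV[R]_d}
    {S : bmatrix} :
  is_slack_matrix A B (tagged S) ->
  perm_class S = [set T | is_slack_matrix A B (tagged T)].
Proof.
case: S => -[m n] S /= [r [c [Ar Bc Sdot]]].
apply/seteqP; split=> [_ [s [t ->]]|[[m' n'] T]] /=.
  exists (r \o s), (c \o t).
  split; [exact: set_bij_perm|exact: set_bij_perm|].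
  by move=> i j; rewrite !mxE Sdot.
move=> [r' [c' [Ar' Bc' Tdot]]]; rewrite /= in r' c' Ar' Bc' Tdot.
have em := bij_card_eq Ar Ar'; have en := bij_card_eq Bc Bc'.
move: T r' c' Ar' Bc' Tdot; case: _ / em; case: _ / en => T r' c' Ar' Bc' Tdot.
have [s r's] := reindex_perm Ar Ar'.
have [t c't] := reindex_perm Bc Bc'.
exists s, t; congr existT; apply/matrixP => i j; rewrite !mxE/=.
apply/eqP; rewrite -(inj_eq (can_inj oddb)) -(eqr_nat R) Tdot Sdot.
by rewrite r's c't.
Qed.

(** * Encoding [A] by two matrices *)

Section QuadraticEncoding.
Variables (R : realType) (d : nat).
Implicit Types (x a b : 'rV[R]_d) (E M N : 'M[R]_d) (A B : set 'rV[R]_d).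

(** The linear term is read off the diagonal: 0/1 numbers equal their squares, so the diagonal of
    [N_b] lists the [<a_i,b>]. This makes the expression linear in [M]. *)
Definition quadric x M : R :=
  (x *m M *m x^T) 0 0 - \sum_i x 0 i * M i i.

Lemma quadric_is_linear x : linear (quadric x : 'M[R]_d -> R^o).
Proof.
move=> k M N; rewrite /quadric.
have -> : \sum_i x 0 i * (k *: M + N) i i =
    k * (\sum_i x 0 i * M i i) + \sum_i x 0 i * N i i.
  by rewrite mulr_sumr -big_split; apply: eq_bigr => i _; rewrite !mxE/=; ring.
rewrite mulmxDr mulmxDl -scalemxAr -scalemxAl [X in X - _]mxE.
rewrite [X in X + _ - _]mxE /GRing.scale/=; ring.
Qed.

HB.instance Definition _ x :=
  GRing.isLinear.Build R 'M[R]_d R^o _ (quadric x) (quadric_is_linear x).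

Lemma dotpE a b : dotp a b = (a *m b^T) 0 0.
Proof. by rewrite mxE; apply: eq_bigr => i _; rewrite mxE. Qed.

(** This is [N_b], with the rows of [E] as [a_1, ..., a_d]. *)
Definition incidence_gram E b : 'M[R]_d := (E *m b^T) *m (E *m b^T)^T.

Lemma incidence_gramE E b i j :
  incidence_gram E b i j = dotp (row i E) b * dotp (row j E) b.
Proof.
rewrite mxE big_ord1 !dotpE -!row_mul [in RHS]mxE.
by rewrite [_^T 0 j]mxE [X in _ = _ * X]mxE.
Qed.

Lemma quadric_gram E x b :
  (forall i, dotp (row i E) b = 0 \/ dotp (row i E) b = 1) ->
  quadric x (incidence_gram E b) = dotp (x *m E) b ^+ 2 - dotp (x *m E) b.
Proof.
move=> Eb; rewrite /quadric; congr (_ - _).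
  rewrite dotpE -(mulmxA x E) /incidence_gram; move: (E *m b^T) => u.
  rewrite mulmxA -(mulmxA (x *m u)) -trmx_mul mxE big_ord1.
  by rewrite [_^T 0 0]mxE expr2.
rewrite dotpE -mulmxA mxE; apply: eq_bigr => i _.
rewrite incidence_gramE.
have -> : (E *m b^T) i 0 = dotp (row i E) b by rewrite dotpE -row_mul [RHS]mxE.
by case: (Eb i) => ->; rewrite ?(mulr0, mulr1).
Qed.

Lemma dotp_int a b :
  zero_one_vectors a -> integer_vectors b -> dotp a b \is a Num.int.
Proof.
move=> a01 bZ; apply: rpred_sum => i _.
by case: (a01 i) => ->; rewrite ?mul0r ?mul1r ?rpred0.
Qed.

Lemma sqr_sub_int_ge0 (s : R) : s \is a Num.int -> 0 <= s ^+ 2 - s.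
Proof.
move=> /intrP[k ->]; rewrite -rmorphXn -rmorphB/= ler0z; nia.
Qed.

Lemma sqr_sub_eq0 (s : R) : s ^+ 2 - s = 0 <-> s = 0 \/ s = 1.
Proof.
split=> [|[]->]; rewrite ?expr0n ?expr1n ?subrr//.
rewrite expr2 -{3}[s]mulr1 -mulrBr => /eqP; rewrite mulf_eq0 subr_eq0.
by case/orP => /eqP ->; [left|right].
Qed.

Definition code : finType := ('M[bool]_d * 'M['I_(d * d).+1]_d)%type.

(* [t.1] lists a basis of vectors of [A] as rows and [t.2] is the matrix M. *)
Definition decode (t : code) : set 'rV[R]_d :=
  [set a | zero_one_vectors a /\
    exists2 x, a = x *m map_mx (fun e : bool => e%:R) t.1 &
      quadric x (map_mx (fun k : 'I_(d * d).+1 => k%:R) t.2) = 0].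

Lemma spanning_matrix A : linear_span A = setT ->
  exists2 E : 'M[R]_d, forall i, A (row i E) & forall a, exists x, a = x *m E.
Proof.
move=> spanA; have [X [fX XA AX]] := set_spanning_free _ _ A.
have fullX v : v \in <<X>>%VS.
  have [Y YA vY] : linear_span A v by rewrite spanA.
  apply: (subvP _ _ vY); apply/span_subvP => w wY; exact/AX/YA.
have sX : size X == d.
  rewrite -(eqP fX) (_ : <<X>>%VS = fullv) ?dimvf ?dim_matrix ?mul1r//.
  by apply/vspaceP => v; rewrite fullX memvf.
exists (\matrix_i X`_i) => [i|a].
  by rewrite rowK; apply: XA; rewrite mem_nth// (eqP sX).
have /coord_span/= aE := fullX a : a \in <<Tuple sX>>%VS.
exists (\row_i coord (Tuple sX) i a); rewrite mulmx_sum_row {1}aE.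
by apply: eq_bigr => i _; rewrite rowK mxE.
Qed.

Lemma two_level_decode A B :
  two_level_configuration A B -> A `<=` @zero_one_vectors R d ->
  B `<=` @integer_vectors R d -> exists t, A = decode t.
Proof.
move=> [spanA _ defA defB] A01 BZ.
have AB01 a b : A a -> B b -> dotp a b = 0 \/ dotp a b = 1.
  by rewrite {1}defA => /[apply].
have [E EA spanE] := spanning_matrix A spanA.
have [Y [fY YB BY]] := set_spanning_free _ _ (incidence_gram E @` B).
pose M : 'M[R]_d := \sum_(N <- Y) N.
have quadB x b : B b ->
    quadric x (incidence_gram E b) = dotp (x *m E) b ^+ 2 - dotp (x *m E) b.
  by move=> Bb; apply: quadric_gram => i; apply: AB01.
have sY : (size Y <= d * d)%N.
  by rewrite -(eqP fY) -[(d * d)%N](dim_matrix R) -dimvf dimvS// subvf.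
have [e Ee] : exists e : 'M[bool]_d, E = map_mx (fun e : bool => e%:R) e.
  exists (\matrix_(i, j) (E i j == 1)); apply/matrixP => i j; rewrite !mxE.
  have := A01 _ (EA i) j; rewrite mxE => -[]->; rewrite ?eqxx//.
  by rewrite eq_sym oner_eq0.
have [k Mk] : exists k : 'M['I_(d * d).+1]_d,
    M = map_mx (fun k : 'I_(d * d).+1 => k%:R) k.
  (* Every [N] in [Y] has 0/1 entries, so an entry of the sum counts the [N] with a 1 there. The
     count is at most [size Y], hence at most [d * d], and [inord] leaves it unchanged. *)
  exists (\matrix_(i, j) inord (count (fun N => N i j == 1) Y)).
  apply/matrixP => i j; rewrite !mxE inordK; last first.
    by rewrite ltnS (leq_trans (count_size _ _)).
  rewrite summxE -sum1_count natr_sum [RHS]big_mkcond/=.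
  apply: eq_big_seq => N /YB[b Bb <-]; rewrite incidence_gramE.
  have [->|->] := AB01 _ b (EA i) Bb; have [->|->] := AB01 _ b (EA j) Bb;
    by rewrite ?(mul0r, mul1r) ?eqxx// eq_sym oner_eq0.
exists (e, k); rewrite /decode/= -Ee -Mk.
apply/seteqP; split=> a /=.
  move=> Aa; split; first exact: A01.
  have [x aE] := spanE a; exists x => //.
  rewrite /M linear_sum big_seq big1// => N /YB[b Bb <-].
  rewrite /= quadB// -aE; exact/sqr_sub_eq0/AB01.
move=> [a01 [x aE quadM]]; rewrite defA => b Bb.
(* By integrality the terms of the sum are nonnegative, so each vanishes when the sum does;
   linearity then carries this from [Y] to every [b] in [B]. *)
have quad_ge0 N : N \in Y -> 0 <= quadric x N.
  move=> /YB[c Bc <-]; rewrite quadB// -aE.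
  by apply/sqr_sub_int_ge0/dotp_int => //; apply: BZ.
have quad0 N : N \in Y -> quadric x N = 0.
  move: quadM; rewrite /M linear_sum big_seq => /eqP.
  rewrite psumr_eq0// => /allP quad0 NY.
  by have := quad0 N NY; rewrite NY => /eqP.
apply/sqr_sub_eq0; rewrite aE -quadB//.
have /(coord_span (X := in_tuple Y)) -> : incidence_gram E b \in <<Y>>%VS.
  by apply: BY; exists b.
rewrite linear_sum big1// => i _.
by rewrite linearZ/= quad0 ?scaler0// mem_nth.
Qed.

(** By maximality [B] is recovered from [A], so every class is the value of [slacks] at some code.
    Codes that decode to no configuration only enlarge the image. *)
Lemma slack_classes_le_code :
  integral_slack_classes R d #<= [set: code].
Proof.
pose slacks (t : code) : set bmatrix := [set S : bmatrix |
  is_slack_matrix (decode t) [set b |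
    forall a, decode t a -> dotp a b = 0 \/ dotp a b = 1] (tagged S)].
apply: (@card_le_trans _ _ _ (slacks @` setT)); last exact: card_image_le.
apply: subset_card_le.
move=> _ [S [A [B [conf A01 BZ slackS]]] <-].
have [t At] := two_level_decode A B conf A01 BZ.
exists t => //; rewrite (perm_class_slack slackS) /slacks -At.
by case: conf => _ _ _ <-.
Qed.

Definition code_bound (n : nat) : nat := (2 ^ (n * n) * (n * n).+1 ^ (n * n))%N.

Lemma card_code : #|code| = code_bound d.
Proof. by rewrite card_prod !card_mx card_bool card_ord. Qed.

Lemma slack_classes_card : exists2 N : nat,
  integral_slack_classes R d #= `I_N & (N <= code_bound d)%N.
Proof.
have finC : finite_set (integral_slack_classes R d).
  exact: card_le_finite slack_classes_le_code finite_finset.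
have [N cN] := finC; exists N => //.
rewrite -card_le_II -(card_le_eql cN) -card_code.
apply: (@card_le_trans _ _ _ [set: code]); first exact: slack_classes_le_code.
rewrite (card_le_eqr (card_II (n := _))).
apply: (@card_le_trans _ _ _ (@enum_val code predT @` setT));
  last exact: card_image_le.
apply: subset_card_le => t _; exists (enum_rank t) => //.
by rewrite enum_rankK.
Qed.

End QuadraticEncoding.

(** * The asymptotic bound *)

Lemma code_bound_gt0 n : (0 < code_bound n)%N.
Proof. by rewrite muln_gt0 !expn_gt0. Qed.

Lemma powR_log2 (R : realType) (x : R) : 0 < x -> 2 `^ log2 x = x.
Proof.
move=> x0; rewrite /powR pnatr_eq0/= /log2 divfK ?lnK//.
by rewrite gt_eqF// ln_gt0// ltr1n.
Qed.

(** For [n >= 2] both [2 <= n] and [n^2 + 1 <= n^3] hold; the exponent 4 splits as 1 + 3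
    accordingly. *)
Lemma code_bound_le n : (2 <= n)%N -> (code_bound n <= n ^ (4 * (n * n)))%N.
Proof.
move=> n2; rewrite expnM -[4%N]/(1 + 3)%N expnD expnMn expn1 /code_bound.
rewrite leq_mul// leq_exp2r ?muln_gt0; nia.
Qed.

Theorem theorem5p1 (R : realType) :
  exists2 h : nat -> R^o,
    h =O_\oo (fun d : nat => d%:R ^+ 2 * log2 (d%:R : R) : R^o) &
    forall d : nat, exists2 N : nat,
      integral_slack_classes R d #= `I_N & N%:R <= 2 `^ h d.
Proof.
(* With this exponent the count holds for every [d], small ones included; only the growth estimate
   is asymptotic. *)
exists (fun d => log2 (code_bound d)%:R : R^o); last first.
  move=> d; have [N cN leN] := slack_classes_card R d.
  exists N => //; rewrite powR_log2 ?ltr0n ?code_bound_gt0//.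
  by rewrite ler_nat.
(* The constant 4 is the factor in the exponent of [code_bound_le], which requires [d >= 2]. *)
apply/eqO_exP; exists 4 => //; near=> d.
have d2 : (2 <= d)%N by near: d; exists 2%N.
have d0 : (0 < d)%N by exact: leq_trans d2.
have ln2 : 0 < ln 2 :> R by rewrite ln_gt0// ltr1n.
have log2_ge0 n : (0 < n)%N -> 0 <= log2 (n%:R : R).
  by move=> n0; rewrite divr_ge0 ?ln_ge0 ?ler1n// ltW.
have main : log2 (code_bound d)%:R <= 4 * (d%:R ^+ 2 * log2 d%:R) :> R.
  have -> : 4 * (d%:R ^+ 2 * log2 d%:R) =
      (4 * (d * d))%:R * ln d%:R / ln 2 :> R by rewrite !natrM expr2 !mulrA.
  rewrite ler_pM2r ?invr_gt0//.
  rewrite mulr_natl -lnXn ?ltr0n// -natrX.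
  by rewrite ler_ln ?posrE ?ltr0n ?code_bound_gt0 ?expn_gt0 ?d0// ler_nat
    code_bound_le.
rewrite (ger0_norm (log2_ge0 _ (code_bound_gt0 d))).
by rewrite ger0_norm ?main// mulr_ge0 ?exprn_ge0// log2_ge0.
Unshelve. all: by end_near.
Qed.
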